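(* Let $S$ be a semidomain, and consider the following statements. (a) $S$ is almost atomic and, for every indecomposable polynomial $\sum_{i=0}^n c_i x^i \in S[x]\setminus\{0\}$, the set $\mathrm{mcd}_S(c_0,\dots,c_n)$ of maximal common divisors of its coefficients is nonempty. (b) The polynomial semidomain $S[x]$ is almost atomic. (c) The Laurent polynomial semidomain $S[x^{\pm 1}]$ is almost atomic. Then (a) implies (b), and (b) implies (c). Moreover, (b) and (c) are equivalent.
   Context: A monoid here is a commutative cancellative semigroup with identity. A semiring is a set $S$ with two operations $+$ and $\cdot$ such that $(S,+)$ is a (commutative, cancellative) monoid with identity $0$, $(S,\cdot)$ is a commutative semigroup with identity $1$, and multiplication distributes over addition. A subsemiring of a semiring (or ring) is an additive submonoid that contains $1$ and is closed under multiplication. A semidomain is a semiring that is a subsemiring of an integral domain. For a semidomain $S$, write $S^* := (S\setminus\{0\},\cdot)$, which is a monoid, called the multiplicative monoid of $S$. $S[x]$ denotes the semiring of polynomials with coefficients in $S$, and $S[x^{\pm 1}]$ the semiring of Laurent polynomials with coefficients in $S$; both are semidomains. For a monoid $M$ (written multiplicatively), a unit is an invertible element; an atom of $M$ is a nonunit $a \in M$ such that $a = bc$ with $b,c\in M$ implies that $b$ or $c$ is a unit. The monoid $M$ is almost atomic if for every nonunit $c \in M$ there exist finitely many atoms $a_1,\dots,a_k$ of $M$ (with $k \ge 0$) such that $a_1\cdots a_k c$ is a finite product of atoms of $M$. A semidomain $S$ is almost atomic if the monoid $S^*$ is almost atomic. A nonzero polynomial in $S[x]$ is indecomposable if it cannot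 be written as a product of two nonconstant polynomials in $S[x]$. For $c_0,\dots,c_n\in S$, not all zero, a common divisor of $c_0,\dots,c_n$ is an element $d \in S^*$ such that for each $i$ there is $s_i\in S$ with $c_i = d s_i$ (so every element of $S^*$ divides $0$). A common divisor $d$ is a maximal common divisor if every common divisor of $c_0/d,\dots,c_n/d$ is a unit of $S^*$. The set of maximal common divisors is denoted $\mathrm{mcd}_S(c_0,\dots,c_n)$. *)

(* Defs.v *)
From HB Require Import structures.
From mathcomp Require Import all_boot all_order all_algebra.
From mathcomp Require Import finmap.

Set Implicit Arguments.
Unset Strict Implicit.
Unset Printing Implicit Defensive.

Import GRing.Theory.

Local Open Scope fset_scope.
Local Open Scope ring_scope.

(* Being a subsemiring of an integral domain is rendered as admitting an
   injective semiring morphism into one.  Cancellativity of (S, +) and the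
   absence of zero divisors in S follow from this property. *)
Definition semidomain (S : comNzSemiRingType) : Prop :=
  exists (R : idomainType) (f : {rmorphism S -> R}), injective f.

(* The monoid S^* consists of the x : S with x != 0; the notions below are
   those of the monoid S^*, with every quantifier restricted to it. *)
Section MultiplicativeMonoid.

Variable S : comNzSemiRingType.
Implicit Types (a c d u : S) (cs : seq S).

Definition star_unit u : Prop := u != 0 /\ exists2 v : S, v != 0 & u * v = 1.

Definition star_atom a : Prop :=
  [/\ a != 0, ~ star_unit a &
      forall b c : S, b != 0 -> c != 0 -> a = b * c ->
        star_unit b \/ star_unit c].

Definition almost_atomic : Prop :=
  forall c, c != 0 -> ~ star_unit c ->
    exists s t : seq S,
      [/\ forall a, a \in s -> star_atom a,
          forall b, b \in t -> star_atom b &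
          (\prod_(a <- s) a) * c = \prod_(b <- t) b].

Definition common_divisor cs d : Prop :=
  d != 0 /\ forall c, c \in cs -> exists s : S, c = d * s.

(* The sequence qs is the sequence of quotients c_0/d, ..., c_n/d, which is
   unique when S is a semidomain. *)
Definition mcd cs d : Prop :=
  common_divisor cs d /\
  exists2 qs : seq S, cs = [seq d * q | q <- qs] &
    forall e, common_divisor qs e -> star_unit e.

Definition indecomposable (p : {poly S}) : Prop :=
  p != 0 /\
  ~ exists q r : {poly S}, [/\ (1 < size q)%N, (1 < size r)%N & p = q * r].

End MultiplicativeMonoid.

(* Laurent polynomials: f k is the coefficient of x^k in f, and multiplication
   is convolution. *)
Definition laurent (S : comNzSemiRingType) := {fsfun int -> S with 0}.

HB.instance Definition _ (S : comNzSemiRingType) :=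
  Choice.copy (laurent S) {fsfun int -> S with 0}.

Section LaurentSemiring.

Variable S : comNzSemiRingType.
Implicit Types (f g h : laurent S) (A B : {fset int}).

Definition laurent0 : laurent S := [fsfun].

Definition laurent1 : laurent S := [fsfun k in [fset 0] => 1 | 0].

Definition laurent_add f g : laurent S :=
  [fsfun k in finsupp f `|` finsupp g => f k + g k | 0].

Definition laurent_mul f g : laurent S :=
  [fsfun k in [fset i + j | i in finsupp f, j in finsupp g] =>
     \sum_(i <- finsupp f) f i * g (k - i) | 0].

Lemma laurent0E k : laurent0 k = 0.
Proof. by rewrite fsfunE. Qed.

Lemma laurent1E k : laurent1 k = (k == 0)%:R.
Proof. by rewrite fsfunE inE; case: eqP. Qed.

Lemma laurent_addE f g k : laurent_add f g k = f k + g k.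
Proof.
rewrite fsfunE inE; case: finsuppP => [_|] //=.
by case: finsuppP => //=; rewrite addr0.
Qed.

Lemma laurent_mulE f g k :
  laurent_mul f g k = \sum_(i <- finsupp f) f i * g (k - i).
Proof.
rewrite fsfunE; case: ifPn => // kN; rewrite big_seq big1 // => i fi.
case: (finsuppP g (k - i)) => [_|gki]; first by rewrite mulr0.
case/negP: kN; apply/imfset2P; exists i => //.
by exists (k - i) => //; rewrite addrC subrK.
Qed.

Lemma sum_fset_supp A B (F : int -> S) :
    (forall i, F i != 0 -> i \in A) -> (forall i, F i != 0 -> i \in B) ->
  \sum_(i <- A) F i = \sum_(i <- B) F i.
Proof.
move=> FA FB; suff sumU (C D : {fset int}) : (forall i, F i != 0 -> i \in C) ->
    \sum_(i <- C) F i = \sum_(i <- C `|` D) F i.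
  by rewrite (sumU A B FA) (sumU B A FB) fsetUC.
move=> FC; apply: big_fset_incl; first exact: fsubsetUl.
by move=> i _ iC; apply/eqP; apply: contraNT iC => /FC.
Qed.

Lemma laurent_mul_supp A f g k : finsupp f `<=` A ->
  laurent_mul f g k = \sum_(i <- A) f i * g (k - i).
Proof.
move=> /fsubsetP sfA; rewrite laurent_mulE.
have nzf i : f i * g (k - i) != 0 -> i \in finsupp f.
  by rewrite mem_finsupp; apply: contraNneq => ->; rewrite mul0r.
by apply: sum_fset_supp => i /nzf // /sfA.
Qed.

Lemma laurent_mulC : commutative laurent_mul.
Proof.
move=> f g; apply/fsfunP => k; rewrite !laurent_mulE.
have kK i : k - (k - i) = i by rewrite opprB addrC subrK.
pose B := [fset k - j | j in finsupp g].
transitivity (\sum_(i <- B) f i * g (k - i)).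
  apply: sum_fset_supp => i nz.
    by rewrite mem_finsupp; apply: contraNneq nz => ->; rewrite mul0r.
  apply/imfsetP; exists (k - i) => //=; rewrite mem_finsupp.
  by apply: contraNneq nz => ->; rewrite mulr0.
rewrite big_imfset /=; last by move=> i j _ _ /(congr1 (+%R k \o -%R))/=; rewrite !kK.
by apply: eq_bigr => j _; rewrite kK mulrC.
Qed.

Lemma laurent_mulA : associative laurent_mul.
Proof.
move=> f g h; apply/fsfunP => k; rewrite laurent_mulE.
pose A := [fset i + j | i in finsupp f, j in finsupp g].
have sA : finsupp (laurent_mul f g) `<=` A.
  apply/fsubsetP => i; rewrite mem_finsupp.
  by apply: contraNT => iA; rewrite fsfunE (negPf iA).
rewrite (laurent_mul_supp _ _ sA).
under [RHS]eq_bigr => m _ do rewrite laurent_mulE mulr_suml.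
rewrite exchange_big /=; apply: eq_big_seq => i fi.
under [RHS]eq_bigr => m _ do rewrite -mulrA.
rewrite -mulr_sumr; congr (_ * _); rewrite laurent_mulE.
have nzg m : g (m - i) * h (k - m) != 0 -> (m - i) \in finsupp g.
  by rewrite mem_finsupp; apply: contraNneq => ->; rewrite mul0r.
rewrite [RHS](@sum_fset_supp _ [fset i + j | j in finsupp g]).
- rewrite big_imfset /=; last by move=> x y _ _ /addrI.
  by apply: eq_bigr => j _; rewrite [i + j]addrC addrK opprD [- j - i]addrC addrA.
- move=> m /nzg gm; apply/imfset2P; exists i => //; exists (m - i) => //.
  by rewrite addrC subrK.
- move=> m /nzg gm; apply/imfsetP; exists (m - i) => //=.
  by rewrite addrC subrK.
Qed.

Lemma laurent_addA : associative laurent_add.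
Proof. by move=> f g h; apply/fsfunP => k; rewrite !laurent_addE addrA. Qed.

Lemma laurent_addC : commutative laurent_add.
Proof. by move=> f g; apply/fsfunP => k; rewrite !laurent_addE addrC. Qed.

Lemma laurent_add0 : left_id laurent0 laurent_add.
Proof. by move=> f; apply/fsfunP => k; rewrite laurent_addE laurent0E add0r. Qed.

Lemma laurent_mul1 : left_id laurent1 laurent_mul.
Proof.
move=> f; apply/fsfunP => k; rewrite (@laurent_mul_supp [fset 0]).
  by rewrite big_seq_fset1 laurent1E eqxx mul1r subr0.
apply/fsubsetP => i; rewrite mem_finsupp laurent1E inE.
by apply: contraNT => /negPf ->.
Qed.

Lemma laurent_mulDl : left_distributive laurent_mul laurent_add.
Proof.
move=> f g h; apply/fsfunP => k; rewrite laurent_addE.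
have sfg : finsupp (laurent_add f g) `<=` finsupp f `|` finsupp g.
  apply/fsubsetP => i; rewrite mem_finsupp.
  by apply: contraNT => iA; rewrite fsfunE (negPf iA).
rewrite (laurent_mul_supp _ _ sfg) (laurent_mul_supp _ _ (fsubsetUl _ (finsupp g))).
rewrite (laurent_mul_supp _ _ (fsubsetUr (finsupp f) _)) -big_split /=.
by apply: eq_bigr => i _; rewrite laurent_addE mulrDl.
Qed.

Lemma laurent_mul0 : left_zero laurent0 laurent_mul.
Proof.
move=> f; apply/fsfunP => k; rewrite laurent_mulE laurent0E big1 // => i _.
by rewrite laurent0E mul0r.
Qed.

Lemma laurent1_neq0 : laurent1 != laurent0.
Proof.
apply/eqP => /fsfunP/(_ 0); rewrite laurent1E laurent0E => /eqP.
by rewrite oner_eq0.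
Qed.

End LaurentSemiring.

HB.instance Definition _ (S : comNzSemiRingType) :=
  GRing.isNmodule.Build (laurent S)
    (@laurent_addA S) (@laurent_addC S) (@laurent_add0 S).

HB.instance Definition _ (S : comNzSemiRingType) :=
  GRing.Nmodule_isComNzSemiRing.Build (laurent S)
    (@laurent_mulA S) (@laurent_mulC S) (@laurent_mul1 S)
    (@laurent_mulDl S) (@laurent_mul0 S) (@laurent1_neq0 S).

(* Main.v *)
Require Import Defs.
From mathcomp Require Import all_boot all_order all_algebra.
From mathcomp Require Import finmap zify.
From Stdlib Require Import Classical.

(** Call [c] almost factorable if [a_1 ... a_k c] is a unit times a product of
    atoms, for some atoms [a_i].  These elements are closed under products, and
    almost atomicity says that every nonzero element is one of them.  A
    polynomial is a product of constants and indecomposable polynomials; if [d]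
    is a maximal common divisor of the coefficients of a nonconstant
    indecomposable [p], then [p / d] is an atom, which gives (a) => (b).  Every
    nonzero Laurent polynomial is uniquely [x^k p] with [p(0) <> 0], and for
    such [p] being a unit, or an atom, means the same in [S[x]] as in
    [S[x^{+-1}]], which gives (b) <=> (c). *)

Set Implicit Arguments.
Unset Strict Implicit.
Unset Printing Implicit Defensive.

Import GRing.Theory.

Local Open Scope fset_scope.
Local Open Scope ring_scope.

(** * Units, atoms and almost factorable elements of a multiplicative monoid *)

Section MultiplicativeMonoid.

Variable S : comNzSemiRingType.
Implicit Types (a b c d u v : S) (s t : seq S).

Definition no_zero_divisors := forall a b, a != 0 -> b != 0 -> a * b != 0.

Lemma star_unitP u : star_unit u <-> exists v, u * v = 1.
Proof.
split=> [[_ [v _ uv]]|[v uv]]; first by exists v.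
split; first by apply: contra_eqN uv => /eqP->; rewrite mul0r eq_sym oner_neq0.
exists v => //.
by apply: contra_eqN uv => /eqP->; rewrite mulr0 eq_sym oner_neq0.
Qed.

Lemma star_unit1 : star_unit (1 : S).
Proof. by apply/star_unitP; exists 1; rewrite mulr1. Qed.

Lemma star_unitM u v : star_unit u -> star_unit v -> star_unit (u * v).
Proof.
move=> /star_unitP[u' uu'] /star_unitP[v' vv']; apply/star_unitP.
by exists (u' * v'); rewrite mulrACA uu' vv' mulr1.
Qed.

Lemma star_unit_mulr u v : star_unit (u * v) -> star_unit v.
Proof.
by move=> /star_unitP[w uvw]; apply/star_unitP; exists (u * w); rewrite mulrCA mulrA.
Qed.

Lemma star_atom_mul_unit u a : star_unit u -> star_atom a -> star_atom (u * a).
Proof.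
move=> /star_unitP[v]; rewrite mulrC => vu [a0 aN aP].
have uK b : v * (u * b) = b by rewrite mulrA vu mul1r.
have v_neq0 b : b != 0 -> v * b != 0.
  by apply: contra_neq => vb0; rewrite -[b]uK mulrCA vb0 mulr0.
split=> [||b c b0 c0 uabc].
- by apply: contra_neq a0 => ua0; rewrite -[a]uK ua0 mulr0.
- by move/star_unit_mulr.
- have abc : a = (v * b) * c by rewrite -mulrA -uabc uK.
  case: (aP _ _ (v_neq0 _ b0) c0 abc) => [/star_unit_mulr|]; first by left.
  by right.
Qed.

(** The factor [u] admits units, for which [s] and [t] are empty, and makes closure under products a
    plain concatenation. *)
Definition almost_factorable c : Prop :=
  exists s t u,
    [/\ forall a, a \in s -> star_atom a, forall b, b \in t -> star_atom b,
        star_unit u & (\prod_(a <- s) a) * c = u * \prod_(b <- t) b].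

Lemma almost_factorable_unit u : star_unit u -> almost_factorable u.
Proof. by move=> uU; exists [::], [::], u; split; rewrite ?big_nil ?mul1r ?mulr1. Qed.

Lemma almost_factorable_atom a : star_atom a -> almost_factorable a.
Proof.
move=> aA; exists [::], [:: a], 1; split=> //.
- by move=> b; rewrite inE => /eqP->.
- exact: star_unit1.
- by rewrite big_nil big_seq1.
Qed.

Lemma almost_factorableM c d :
  almost_factorable c -> almost_factorable d -> almost_factorable (c * d).
Proof.
move=> [s [t [u [sA tA uU sc]]]] [s' [t' [u' [sA' tA' uU' sd]]]].
exists (s ++ s'), (t ++ t'), (u * u'); split.
- by move=> a; rewrite mem_cat => /orP[/sA|/sA'].
- by move=> a; rewrite mem_cat => /orP[/tA|/tA'].
- exact: star_unitM.
- by rewrite !big_cat /= mulrACA sc sd mulrACA.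
Qed.

Lemma almost_atomicP :
  almost_atomic S <-> forall c, c != 0 -> almost_factorable c.
Proof.
split=> [atS c c0|afS c c0 cN].
  case: (classic (star_unit c)) => [|cN]; first exact: almost_factorable_unit.
  have [s [t [sA tA sc]]] := atS c c0 cN.
  by exists s, t, 1; split; rewrite ?mul1r //; apply: star_unit1.
(* If [t] is empty, then [c] divides the unit [u], which is excluded; otherwise [u] is absorbed into
   the first atom of [t]. *)
have [s [[|b t] [u [sA tA uU]]]] := afS c c0.
  by rewrite big_nil mulr1 => sc; rewrite -sc in uU; case: cN; apply: star_unit_mulr uU.
rewrite big_cons mulrA => sc; exists s, (u * b :: t); rewrite big_cons; split=> //.
move=> a; rewrite inE => /orP[/eqP->|at_]; last by apply: tA; rewrite inE at_ orbT.
by apply: star_atom_mul_unit => //; apply: tA; rewrite inE eqxx.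
Qed.

End MultiplicativeMonoid.

Lemma semidomain_nzd (S : comNzSemiRingType) : semidomain S -> no_zero_divisors S.
Proof.
move=> [R [f f_inj]] a b; have f_eq0 c : (f c == 0) = (c == 0).
  by rewrite -(inj_eq f_inj) rmorph0.
by rewrite -!f_eq0 rmorphM mulf_eq0 negb_or => -> ->.
Qed.

(** * Factorization in the polynomial semidomain *)

Section Polynomials.

Variable S : comNzSemiRingType.
Hypothesis nzd : no_zero_divisors S.
Implicit Types (c d : S) (p q : {poly S}).

Lemma size_mul_nzd p q : p != 0 -> q != 0 -> size (p * q) = (size p + size q).-1.
Proof. by move=> p0 q0; rewrite size_proper_mul // nzd // lead_coef_eq0. Qed.

(** Degrees add, so the factors of a nonzero constant are constants; units and atoms of S thus keep
    their status in S[x]. *)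
Lemma mul_polyC_eq c p q : c != 0 -> c%:P = p * q ->
  exists a b, [/\ p = a%:P, q = b%:P & c = a * b].
Proof.
move=> c0 cpq; have pq0 : p * q != 0 by rewrite -cpq polyC_eq0.
have p0 : p != 0 by apply: contra_neq pq0 => ->; rewrite mul0r.
have q0 : q != 0 by apply: contra_neq pq0 => ->; rewrite mulr0.
have := size_mul_nzd p0 q0; rewrite -cpq size_polyC c0 => spq.
have [sp sq] : (size p <= 1)%N /\ (size q <= 1)%N.
  by move: p0 q0 spq; rewrite -!size_poly_eq0; lia.
move: cpq; rewrite (size1_polyC sp) (size1_polyC sq) -polyCM => /polyC_inj cab.
by exists p`_0, q`_0.
Qed.

Lemma star_unit_polyC c : star_unit c%:P <-> star_unit c.
Proof.
rewrite !star_unitP; split=> [[p]|[d cd]]; last by exists d%:P; rewrite -polyCM cd.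
rewrite -polyC1 => /esym/(mul_polyC_eq (oner_neq0 S)) [a [b [/polyC_inj-> _ ab]]].
by exists b.
Qed.

Lemma star_atom_polyC c : star_atom c -> star_atom c%:P.
Proof.
move=> [c0 cN cP]; split=> [||p q]; rewrite ?polyC_eq0 ?star_unit_polyC //.
move=> p0 q0 /(mul_polyC_eq c0)[a [b [ep eq_ cab]]].
move: p0 q0; rewrite {}ep {}eq_ !polyC_eq0 !star_unit_polyC => a0 b0.
exact: cP.
Qed.

Lemma almost_factorable_polyC c : almost_factorable c -> almost_factorable c%:P.
Proof.
move=> [s [t [u [sA tA uU sc]]]].
exists (map polyC s), (map polyC t), u%:P; split.
- by move=> _ /mapP[a /sA /star_atom_polyC ? ->].
- by move=> _ /mapP[a /tA /star_atom_polyC ? ->].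
- exact/star_unit_polyC.
- by rewrite !big_map -!rmorph_prod -!polyCM sc.
Qed.

(** In any factorization one factor is constant by indecomposability; it divides every coefficient,
    hence is a unit. *)
Lemma star_atom_indecomposable q : (1 < size q)%N -> indecomposable q ->
  (forall e, common_divisor q e -> star_unit e) -> star_atom q.
Proof.
move=> q_gt1 [q0 q_indec] qP.
have constU c r : c != 0 -> q = c%:P * r -> star_unit c%:P.
  move=> c0 qcr; apply/star_unit_polyC/qP; split=> // d /(nthP 0)[i _ <-].
  by exists r`_i; rewrite qcr coefCM.
split=> // [/star_unitP[r qr]|b c b0 c0 qbc].
  have [a [_ [qa _ _]]] : exists a b, [/\ q = a%:P, r = b%:P & 1 = a * b].
    by apply: mul_polyC_eq; rewrite ?oner_neq0.
  by move: q_gt1; rewrite qa ltnNge size_polyC_leq1.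
case: (leqP (size b) 1) => [/size1_polyC eb|b_gt1].
  left; rewrite eb; apply: (@constU _ c); last by rewrite -eb.
  by rewrite -polyC_eq0 -eb.
case: (leqP (size c) 1) => [/size1_polyC ec|c_gt1].
  right; rewrite ec; apply: (@constU _ b); last by rewrite -ec mulrC.
  by rewrite -polyC_eq0 -ec.
by case: q_indec; exists b, c.
Qed.

Lemma mcd_factor p d : p != 0 -> mcd p d ->
  exists2 q, p = d%:P * q & forall e, common_divisor q e -> star_unit e.
Proof.
move=> p0 [_ [qs pqs qsP]].
(* A nonzero last entry makes [qs] the exact coefficient sequence of [Poly qs], with nothing
   truncated. *)
have last_qs : last 1 qs != 0.
  (* The sequence of [p] is nonempty, so the default is never returned; [d * 1] is the shape
     produced by [last_map]. *)
  have : last (d * 1) p != 0.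
    move: p0; rewrite -lead_coef_eq0 lead_coefE nth_last.
    by case: (polyseq p) => [|? ?] //=; rewrite eqxx.
  by rewrite pqs last_map; apply: contra_neq => ->; rewrite mulr0.
have Pqs := PolyK last_qs; exists (Poly qs); last by rewrite Pqs.
apply/polyP => i; rewrite coefCM Pqs pqs.
case: (ltnP i (size qs)) => iqs; first by rewrite (nth_map 0).
by rewrite !nth_default ?mulr0 ?size_map.
Qed.

Lemma almost_factorable_indecomposable p : almost_atomic S ->
    (1 < size p)%N -> indecomposable p -> (exists d, mcd p d) ->
  almost_factorable p.
Proof.
move=> /almost_atomicP atS p_gt1 [p0 p_indec] [d dP].
have [q pdq qP] := mcd_factor p0 dP.
have d0 : d != 0 by case: dP => [[]].
have q0 : q != 0 by apply: contra_neq p0; rewrite pdq => ->; rewrite mulr0.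
have sizeZ r : r != 0 -> size (d%:P * r) = size r.
  by move=> r0; rewrite size_mul_nzd ?polyC_eq0 // size_polyC d0.
rewrite pdq; apply: almost_factorableM.
  exact/almost_factorable_polyC/atS.
apply/almost_factorable_atom/star_atom_indecomposable => //.
  by rewrite -sizeZ // -pdq.
(* A decomposition of [q] becomes one of [p] once [d] is multiplied into a factor. *)
split=> // -[b [c [b_gt1 c_gt1 qbc]]]; apply: p_indec.
exists (d%:P * b), c; split=> //; last by rewrite -mulrA -qbc.
by rewrite sizeZ // -size_poly_gt0; apply: ltn_trans b_gt1.
Qed.

Lemma almost_atomic_poly : almost_atomic S ->
  (forall p : {poly S}, indecomposable p -> exists d, mcd p d) ->
  almost_atomic {poly S}.
Proof.
move=> atS mcdS; apply/almost_atomicP => p.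
(* Strong induction on the size: a decomposable polynomial has two nonconstant factors, both of
   smaller degree. *)
have [n] := ubnP (size p); elim: n p => // n IHn p; rewrite ltnS => sp p0.
case: (leqP (size p) 1) => [/size1_polyC ep|p_gt1].
  move: p0; rewrite ep polyC_eq0 => c0.
  by apply: almost_factorable_polyC; move/almost_atomicP: atS; apply.
case: (classic (indecomposable p)) => [p_indec|].
  exact/almost_factorable_indecomposable/mcdS.
move=> /not_and_or[] // /NNPP [b [c [b_gt1 c_gt1 pbc]]].
have b0 : b != 0 by rewrite -size_poly_gt0; apply: ltn_trans b_gt1.
have c0 : c != 0 by rewrite -size_poly_gt0; apply: ltn_trans c_gt1.
have := size_mul_nzd b0 c0; rewrite -pbc => spbc.
by rewrite pbc; apply: almost_factorableM; apply: IHn => //; lia.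
Qed.

(** * The indeterminate as an atom *)

Lemma star_atom_polyX : star_atom ('X : {poly S}).
Proof.
split=> [||b c b0 c0 Xbc]; first by rewrite polyX_eq0.
  move=> /star_unitP[q /(congr1 (fun r : {poly S} => r`_0))].
  by rewrite coefXM coef1 => /eqP; rewrite eq_sym oner_eq0.
(* Two constants cannot multiply to x, so by symmetry [b] is the nonconstant factor. *)
wlog b_gt1 : b c b0 c0 Xbc / (1 < size b)%N => [wl|].
  case: (ltnP 1 (size b)) => [|b_le1]; first exact: wl.
  rewrite or_comm; apply: wl => //; first by rewrite mulrC.
  have := size_mul_nzd b0 c0; rewrite -Xbc size_polyX.
  by move: b0 b_le1; rewrite -size_poly_eq0; lia.
have c_le1 : (size c <= 1)%N.
  by have := size_mul_nzd b0 c0; rewrite -Xbc size_polyX; lia.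
(* As [c] is constant, comparing the coefficients of x shows that [b_1] is its inverse. *)
right; apply/star_unitP; exists (b`_1)%:P.
move: Xbc; rewrite mulrC (size1_polyC c_le1) => /(congr1 (fun r : {poly S} => r`_1)).
by rewrite coefX coefCM -polyCM /= => <-.
Qed.

Lemma polyX_factor p : p`_0 = 0 -> p = drop_poly 1 p * 'X.
Proof.
move=> p0; rewrite -[LHS](poly_take_drop 1) (_ : take_poly 1 p = 0) ?add0r //.
by apply/polyP => -[|i]; rewrite coef_take_poly coef0.
Qed.

(** Such an atom is divisible by the nonunit x, so the cofactor is a unit. These are the atoms that
    turn into units in the Laurent semidomain. *)
Lemma star_atom_coef0 p : star_atom p -> p`_0 = 0 ->
  exists2 u, star_unit u & p = u * 'X.
Proof.
move=> [p0 pN pP] p00; pose u := drop_poly 1 p.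
have pu : p = u * 'X by apply: polyX_factor.
have u0 : u != 0 by apply: contra_neq p0; rewrite pu => ->; rewrite mul0r.
case: (pP u 'X u0 _ pu) => [|uU|XU]; first by rewrite polyX_eq0.
  by exists u.
by case: star_atom_polyX.
Qed.

End Polynomials.

(** * Laurent monomials and the embedding of S[x] *)

Section LaurentPolynomials.

Variable S : comNzSemiRingType.
Hypothesis nzd : no_zero_divisors S.
Implicit Types (f g : laurent S) (p q : {poly S}) (k l : int).

Definition laurent_monomial k : laurent S := [fsfun j in [fset k] => 1 | 0].

Definition laurent_of_poly p : laurent S :=
  [fsfun k in [fset Posz i | i in iota 0 (size p)] => p`_(absz k) | 0].

Local Notation "''x^' k" := (laurent_monomial k) (at level 8, k at level 2).
Local Notation "p %:L" := (laurent_of_poly p) (at level 2, format "p %:L").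

Lemma laurent_oneE k : (1 : laurent S) k = (k == 0)%:R.
Proof. exact: laurent1E. Qed.

Lemma laurent_zeroE k : (0 : laurent S) k = 0.
Proof. exact: laurent0E. Qed.

Lemma laurent_monomial_mulE k f j : ('x^k * f) j = f (j - k).
Proof.
rewrite [LHS](@laurent_mul_supp _ [fset k]).
  by rewrite big_seq_fset1 fsfunE inE eqxx mul1r.
apply/fsubsetP => i; rewrite mem_finsupp fsfunE.
by case: ifP => //; rewrite eqxx.
Qed.

Lemma laurent_monomialM k l : 'x^k * 'x^l = 'x^(k + l).
Proof.
apply/fsfunP => j; rewrite laurent_monomial_mulE !fsfunE !inE.
by rewrite subr_eq addrC.
Qed.

Lemma laurent_monomial0 : 'x^0 = 1.
Proof. by apply/fsfunP => j; rewrite [LHS]fsfunE inE laurent_oneE; case: eqP. Qed.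

Lemma star_unit_laurent_monomial k : star_unit 'x^k.
Proof.
apply/star_unitP; exists ('x^(- k)).
by rewrite laurent_monomialM subrr laurent_monomial0.
Qed.

Lemma laurent_of_polyE p k : p%:L k = if k is Posz n then p`_n else 0.
Proof.
rewrite fsfunE; case: imfsetP => [[i _ ->] //|kp].
case: k kp => // n kp; rewrite nth_default // leqNgt; apply/negP => n_lt.
by apply: kp; exists n => //=; rewrite mem_iota.
Qed.

Lemma laurent_of_poly1 : 1%:L = 1.
Proof. by apply/fsfunP => -[n|n]; rewrite laurent_of_polyE laurent_oneE ?coef1. Qed.

Lemma laurent_of_polyM p q : (p * q)%:L = p%:L * q%:L.
Proof.
apply/fsfunP => k; rewrite laurent_of_polyE [RHS]laurent_mulE.
case: k => n; last first.
  rewrite big1 // => -[i|i] _; rewrite !laurent_of_polyE ?mul0r //.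
  by case E: (Negz n - Posz i) => [m|m]; rewrite ?mulr0 //; lia.
(* Outside the exponents 0 to [n], one of the two coefficients has a negative index and vanishes. *)
rewrite (@sum_fset_supp _ _ [fset Posz i | i in iota 0 n.+1]).
- rewrite big_imfset; last by move=> i j _ _ [].
  rewrite (perm_big (index_iota 0 n.+1)); last first.
    apply: uniq_perm (iota_uniq _ _) _ => [|i]; first exact: enum_finmem_uniq.
    exact: enum_finmemE.
  rewrite coefM big_mkord; apply: eq_bigr => i _.
  by rewrite !laurent_of_polyE subzn // -ltnS.
- by move=> i; rewrite mem_finsupp; apply: contra_neq => ->; rewrite mul0r.
- move=> i; rewrite !laurent_of_polyE; case: i => [i|i]; last by rewrite mul0r eqxx.
  case E: (Posz n - Posz i) => [m|m]; last by rewrite mulr0 eqxx.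
  by move=> _; apply/imfsetP; exists i => //; rewrite inE mem_iota; lia.
Qed.

Lemma laurent_of_polyX : 'X%:L = 'x^1.
Proof.
apply/fsfunP => -[n|n]; rewrite laurent_of_polyE fsfunE inE ?coefX //.
by rewrite eqz_nat; case: eqP.
Qed.

Lemma laurent_of_poly_eq0 p : (p%:L == 0) = (p == 0).
Proof.
apply/eqP/eqP => [pL0|->].
  apply/polyP => n; move/fsfunP/(_ (Posz n)): pL0.
  by rewrite laurent_of_polyE laurent_zeroE coef0.
by apply/fsfunP => -[n|n]; rewrite laurent_of_polyE laurent_zeroE ?coef0.
Qed.

Lemma coef0_neq0 p : p`_0 != 0 -> p != 0.
Proof. by apply: contra_neq => ->; rewrite coef0. Qed.

Lemma coef0_mul_neq0 p q : p`_0 != 0 -> q`_0 != 0 -> (p * q)`_0 != 0.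
Proof. by move=> p0 q0; rewrite coef0M nzd. Qed.

(** * Normal form of Laurent polynomials; units and atoms *)

Lemma laurent_factor f : f != 0 -> exists k p, p`_0 != 0 /\ f = 'x^k * p%:L.
Proof.
(* [B] bounds the absolute values of all exponents in the support, so shifting by [B] makes them
   natural numbers and a least one can be picked. *)
move=> f0; pose B := (\sum_(i <- finsupp f) absz i)%N.
have leB j : f j != 0 -> (absz j <= B)%N.
  by rewrite -mem_finsupp => fj; rewrite /B (big_fsetD1 j) //= leq_addr.
have [j fj] : exists j, f j != 0.
  case: (fset_0Vmem (finsupp f)) => [fe|[j]]; last by rewrite mem_finsupp; exists j.
  case/eqP: f0; apply/fsfunP => j; rewrite laurent_zeroE; apply/eqP/negPn.
  by rewrite -mem_finsupp fe inE.
have exn : exists n, f (Posz n - Posz B) != 0.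
  exists (absz (j + Posz B)); rewrite gez0_abs ?addrK //.
  by have := leB _ fj; lia.
case: (ex_minnP exn) => m fm m_min; pose k : int := Posz m - Posz B.
(* Here [k] is the lowest exponent; all exponents lie between [-B] and [B], so [2B + 1] coefficients
   suffice. *)
exists k, (\poly_(i < B + B + 1) f (k + Posz i)).
split; first by rewrite coef_poly addn1 /= addr0.
apply/fsfunP => i; rewrite laurent_monomial_mulE laurent_of_polyE.
case E: (i - k) => [n|n].
  rewrite coef_poly -E addrC subrK; case: ifP => // n_ge.
  apply/eqP; apply: contraFT n_ge => /leB; rewrite /k in E *; lia.
apply/eqP/negPn/negP => fi; have fiB := leB _ fi.
have := m_min (absz (i + Posz B)); rewrite gez0_abs ?addrK; last by lia.
by move=> /(_ fi); rewrite /k in E; lia.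
Qed.

Lemma laurent_factor_uniq k l p q : p`_0 != 0 -> q`_0 != 0 ->
  'x^k * p%:L = 'x^l * q%:L -> k = l /\ p = q.
Proof.
move=> p0 q0 /fsfunP E.
have {}E j : p%:L (j - k) = q%:L (j - l) by rewrite -!laurent_monomial_mulE.
have kl : k = l.
  (* If [k] and [l] differed, comparing coefficients at the smaller one would make a constant term
     vanish. *)
  have := E k; have := E l; rewrite !subrr ![_%:L 0]laurent_of_polyE !laurent_of_polyE.
  case E1: (l - k) => [a|a] ep; last by case/eqP: q0.
  case E2: (k - l) => [b|b] eq_; last by case/eqP: p0.
  by lia.
split=> //; apply/polyP => n; have := E (Posz n + k).
by rewrite -kl addrK !laurent_of_polyE.
Qed.

Lemma star_unit_laurent_of_poly p : p`_0 != 0 -> star_unit p%:L <-> star_unit p.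
Proof.
move=> p0; rewrite !star_unitP; split=> [[f pf]|[q pq]]; last first.
  by exists q%:L; rewrite -laurent_of_polyM pq laurent_of_poly1.
have f0 : f != 0.
  by apply: contra_eqN pf => /eqP->; rewrite mulr0 eq_sym oner_neq0.
(* Put the inverse in normal form; uniqueness applied to the product, which equals 1, gives
   [p * q = 1]. *)
have [k [q [q0 fq]]] := laurent_factor f0; exists q.
have [] // := @laurent_factor_uniq k 0 (p * q) 1.
- exact: coef0_mul_neq0.
- by rewrite coef1 oner_neq0.
- by rewrite laurent_monomial0 laurent_of_poly1 mul1r -pf fq laurent_of_polyM mulrCA.
Qed.

(** Polynomial factors of [p] inherit a nonzero constant term. Conversely, normal forms turn a
    Laurent factorization into one of [p], up to monomials, which are units. *)
Lemma star_atom_laurent_of_poly p : p`_0 != 0 -> star_atom p%:L <-> star_atom p.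
Proof.
move=> p0; have pn0 := coef0_neq0 p0.
split=> -[_ pN pP]; split=> //.
- by rewrite -star_unit_laurent_of_poly.
- move=> b c bn0 cn0 pbc; move: (p0); rewrite pbc coef0M => bc0.
  have b0 : b`_0 != 0 by apply: contra_neq bc0 => ->; rewrite mul0r.
  have c0 : c`_0 != 0 by apply: contra_neq bc0 => ->; rewrite mulr0.
  rewrite -(star_unit_laurent_of_poly b0) -(star_unit_laurent_of_poly c0).
  by apply: pP; rewrite ?laurent_of_poly_eq0 // -laurent_of_polyM pbc.
- by rewrite laurent_of_poly_eq0.
- by rewrite star_unit_laurent_of_poly.
- move=> f g /laurent_factor[k [b [b0 ->]]] /laurent_factor[l [c [c0 ->]]].
  rewrite mulrACA laurent_monomialM -laurent_of_polyM -[LHS]mul1r -laurent_monomial0.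
  move=> /(laurent_factor_uniq p0 (coef0_mul_neq0 b0 c0))[_ pbc].
  case: (pP b c (coef0_neq0 b0) (coef0_neq0 c0) pbc) => [bU|cU]; [left|right];
    apply: star_unitM (star_unit_laurent_monomial _) _;
    exact/star_unit_laurent_of_poly.
Qed.

(** * Transfer of almost factorability between S[x] and the Laurent semidomain *)

(** Atoms with nonzero constant term remain atoms; the others are associates of x and are collected
    in [u]. *)
Lemma prod_star_atom_laurent_of_poly (s : seq {poly S}) :
    (forall p, p \in s -> star_atom p) ->
  exists t u, [/\ forall f, f \in t -> star_atom f, star_unit u &
    (\prod_(p <- s) p)%:L = u * \prod_(f <- t) f].
Proof.
elim: s => [_|p s IHs sA].
  exists [::], 1; rewrite !big_nil laurent_of_poly1 mulr1.
  by split=> //; apply: star_unit1.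
have [|t [u [tA uU tu]]] := IHs.
  by move=> q qs; apply: sA; rewrite inE qs orbT.
have pA : star_atom p by apply: sA; rewrite inE eqxx.
rewrite big_cons laurent_of_polyM tu; have [p0|p0] := eqVneq p`_0 0.
  have [v vU ->] := star_atom_coef0 nzd pA p0.
  exists t, ('x^1 * v%:L * u); split=> //.
    apply: star_unitM uU; apply: star_unitM (star_unit_laurent_monomial _) _.
    have /star_unitP[w vw] := vU; apply/star_unitP; exists w%:L.
    by rewrite -laurent_of_polyM vw laurent_of_poly1.
  by rewrite laurent_of_polyM laurent_of_polyX [v%:L * _]mulrC !mulrA.
exists (p%:L :: t), u; rewrite big_cons mulrCA; split=> // f.
rewrite inE => /orP[/eqP->|/tA //]; exact/star_atom_laurent_of_poly.
Qed.

Lemma prod_star_atom_laurent_factor (t : seq (laurent S)) :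
    (forall f, f \in t -> star_atom f) ->
  exists s k, [/\ forall p, p \in s -> star_atom p, (\prod_(p <- s) p)`_0 != 0 &
    \prod_(f <- t) f = 'x^k * (\prod_(p <- s) p)%:L].
Proof.
elim: t => [_|f t IHt tA].
  exists [::], 0; rewrite !big_nil coef1 oner_neq0.
  by rewrite laurent_of_poly1 laurent_monomial0 mulr1.
have [|s [k [sA s0 ts]]] := IHt.
  by move=> g gt; apply: tA; rewrite inE gt orbT.
have fA : star_atom f by apply: tA; rewrite inE eqxx.
have [l [p [p0 fp]]] : exists l (p : {poly S}), p`_0 != 0 /\ f = 'x^l * p%:L.
  by case: fA => /laurent_factor.
have pA : star_atom p.
  apply/star_atom_laurent_of_poly => //.
  have -> : p%:L = 'x^(- l) * f.
    by rewrite fp mulrA laurent_monomialM addNr laurent_monomial0 mul1r.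
  exact: star_atom_mul_unit (star_unit_laurent_monomial _) fA.
exists (p :: s), (l + k); rewrite !big_cons; split.
- by move=> q; rewrite inE => /orP[/eqP->|/sA].
- exact: coef0_mul_neq0.
- by rewrite fp ts laurent_of_polyM mulrACA laurent_monomialM.
Qed.

Lemma almost_factorable_laurent_of_poly p :
  almost_factorable p -> almost_factorable p%:L.
Proof.
move=> [s [t [u [sA tA uU sp]]]].
have [s' [v [sA' vU es]]] := prod_star_atom_laurent_of_poly sA.
have [t' [w [tA' wU et]]] := prod_star_atom_laurent_of_poly tA.
have /star_unitP[v' vv'] := vU; have /star_unitP[u' uu'] := uU.
(* The embedded products over [s] and [t] carry the units [v] and [w]; dividing by [v] gives this
   factor. *)
exists s', t', (v' * (u%:L * w)); split=> //.
  apply: star_unitM; first by apply/star_unitP; exists v; rewrite mulrC.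
  apply: star_unitM wU; apply/star_unitP; exists u'%:L.
  by rewrite -laurent_of_polyM uu' laurent_of_poly1.
have /(congr1 laurent_of_poly) := sp; rewrite !laurent_of_polyM es et => E.
by rewrite -!mulrA -E !mulrA [v' * v]mulrC vv' mul1r.
Qed.

Lemma almost_factorable_of_laurent p : p`_0 != 0 ->
  almost_factorable p%:L -> almost_factorable p.
Proof.
move=> p0 [s [t [f [sA tA fU sp]]]].
have [s' [k [sA' s0 es]]] := prod_star_atom_laurent_factor sA.
have [t' [l [tA' t0 et]]] := prod_star_atom_laurent_factor tA.
have [m [u [u0 fu]]] : exists m (u : {poly S}), u`_0 != 0 /\ f = 'x^m * u%:L.
  by case: fU => /laurent_factor.
have uU : star_unit u.
  by apply/star_unit_laurent_of_poly => //; move: fU; rewrite fu; apply: star_unit_mulr.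
exists s', t', u; split=> //.
(* Both sides are now a monomial times a polynomial with nonzero constant term; uniqueness discards
   the monomials. *)
move: sp; rewrite es et fu mulrACA laurent_monomialM -mulrA -!laurent_of_polyM.
by case/laurent_factor_uniq; rewrite ?coef0_mul_neq0.
Qed.

Lemma almost_atomic_laurent : almost_atomic {poly S} -> almost_atomic (laurent S).
Proof.
move=> /almost_atomicP atP; apply/almost_atomicP => _ /laurent_factor[k [p [p0 ->]]].
apply: almost_factorableM; first exact/almost_factorable_unit/star_unit_laurent_monomial.
exact/almost_factorable_laurent_of_poly/atP/coef0_neq0.
Qed.

Lemma almost_atomic_of_laurent :
  almost_atomic (laurent S) -> almost_atomic {poly S}.
Proof.
move=> /almost_atomicP atL; apply/almost_atomicP => p.
have [n] := ubnP (size p); elim: n p => // n IHn p sp pn0.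
have [p0|p0] := eqVneq p`_0 0; last first.
  by apply/almost_factorable_of_laurent/atL; rewrite ?laurent_of_poly_eq0.
(* With zero constant term, [p] has the atom x as a factor, and the cofactor has smaller size. *)
have pX := polyX_factor p0.
rewrite pX; apply: almost_factorableM.
  apply: IHn; last by apply: contra_neq pn0 => e; rewrite pX e mul0r.
  by rewrite size_drop_poly; move: pn0 sp; rewrite -size_poly_gt0; lia.
exact/almost_factorable_atom/star_atom_polyX.
Qed.

End LaurentPolynomials.

Theorem theorem4p2 (S : comNzSemiRingType) (hS : semidomain S) :
  ((almost_atomic S /\
    (forall p : {poly S}, indecomposable p -> exists d : S, mcd p d)) ->
   almost_atomic {poly S}) /\
  (almost_atomic {poly S} -> almost_atomic (laurent S)) /\
  (almost_atomic {poly S} <-> almost_atomic (laurent S)).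
Proof.
have nzd := semidomain_nzd hS.
split; [by case; apply: almost_atomic_poly|split; [exact: almost_atomic_laurent|split]].
- exact: almost_atomic_laurent.
- exact: almost_atomic_of_laurent.
Qed.
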